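(* Let $\kappa>0$ and let $a,b>0$ satisfy $a+b=\kappa$. Then for every $\mu\in\mathbb{R}$, $$(1+e^{-\mu})^{-\kappa}=B(a,b)\,e^{a\mu}\int_0^\infty\frac{1}{\sqrt{2\pi\lambda}}\exp\left\{-\frac{1}{2\lambda}\left(-\mu-\frac12(a-b)\lambda\right)^2\right\}q_{a,b}(\lambda)\,d\lambda,$$ where $B$ is the Beta function and $q_{a,b}$ is the Polya density.
   Context: For $a,b>0$, the Polya density $q_{a,b}$ on $(0,\infty)$ is $$q_{a,b}(\lambda)=\sum_{k=0}^\infty w_k e^{-\frac12\psi_k\lambda},\qquad \psi_k=(a+k)(b+k),$$ with, for $\delta=(a+b)/2$ and $\theta=(a-b)/2$, $$w_k=\binom{-2\delta}{k}\frac{\delta+k}{B(\delta+\theta,\delta-\theta)}=\frac{(-1)^k(2\delta)(2\delta+1)\cdots(2\delta+k-1)}{k!}\cdot\frac{\delta+k}{B(\delta+\theta,\delta-\theta)},$$ where $B$ is the Beta function (so $B(\delta+\theta,\delta-\theta)=B(a,b)$). Equivalently, $q_{a,b}$ is the density of $\sum_{k=0}^\infty 2\psi_k^{-1}\epsilon_k$, where the $\epsilon_k$ are i.i.d. exponential random variables with mean $1$. *)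

(* Defs.v *)
From HB Require Import structures.
From mathcomp Require Import all_boot all_order all_algebra.
From mathcomp Require Import all_classical all_reals all_analysis.

Set Implicit Arguments.
Unset Strict Implicit.
Unset Printing Implicit Defensive.

Import Order.TTheory GRing.Theory Num.Theory.
Import numFieldNormedType.Exports.

Local Open Scope classical_set_scope.
Local Open Scope ring_scope.

(* The library's [beta_fun] only takes natural-number parameters.  For
   [0 < a] and [0 < b] the integrand is integrable on ]0, 1[. *)
Definition Beta (R : realType) (a b : R) : R :=
  \int[lebesgue_measure]_(t in `]0, 1[) (t `^ (a - 1) * (1 - t) `^ (b - 1)).

Definition gbinom (R : realType) (x : R) (k : nat) : R :=
  (\prod_(i < k) (x - i%:R)) / k`!%:R.

Definition polya_rate (R : realType) (a b : R) (k : nat) : R :=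
  (a + k%:R) * (b + k%:R).

Definition polya_weight (R : realType) (a b : R) (k : nat) : R :=
  let delta := (a + b) / 2 in
  let theta := (a - b) / 2 in
  gbinom (- (2 * delta)) k * ((delta + k%:R) / Beta (delta + theta) (delta - theta)).

(* Only meaningful for [0 < lambda], where the series converges absolutely. *)
Definition polya_density (R : realType) (a b lambda : R) : R :=
  limn (series (fun k =>
    polya_weight a b k * expR (- (1 / 2) * polya_rate a b k * lambda))).

(* Main.v *)
Require Import Defs.
From HB Require Import structures.
From mathcomp Require Import all_boot all_order all_algebra.
From mathcomp Require Import all_classical all_reals all_analysis.
From mathcomp Require Import measurable_realfun.
From mathcomp Require Import ring lra.

Set Implicit Arguments.
Unset Strict Implicit.
Unset Printing Implicit Defensive.

Import Order.TTheory GRing.Theory Num.Theory.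
Import numFieldNormedType.Exports.

Local Open Scope classical_set_scope.
Local Open Scope ring_scope.

(* Write d = (a + b) / 2, c_k = d + k, and let b_k x^k be the terms of the series
   of (1 - x)^(-2 d).  Completing the square, the integrand is, up to the factor
   exp (- (a - b) / 2 * mu) / B(a, b), the product of
   (2 pi x)^(-1/2) exp (- mu^2 / (2 x)) and
   theta x = sum_k (-1)^k b_k c_k exp (- c_k^2 x / 2).
   For m = |mu| > 0 the terms of the product integrate to
   (-1)^k b_k exp (- c_k m), so dominated convergence and the binomial series give
   exp (- d m) (1 + exp (- m))^(-2 d).  At mu = 0 the integrated series no longer
   converges; there the identity follows from monotone convergence as m decreases
   to 0, because theta >= 0.  This positivity reflects that theta is, up to
   exponential and constant factors, a limit of densities of sums of independent
   exponential variables, which are nonnegative by induction through the linear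
   differential equation of a convolution with an exponential density. *)

(** * The binomial series of (1 - x)^(-p), for x in ]-1, 1[ *)

Section NegativeBinomial.
Variable R : realType.
Implicit Types (p x y : R) (k n : nat).

Fact negbinom_key : unit. Proof. by []. Qed.

(* Locked, since otherwise lemmas about products also rewrite inside it. *)
Definition negbinom p k : R :=
  locked_with negbinom_key ((\prod_(i < k) (p + i%:R)) / k`!%:R).

Lemma negbinomE p k :
  negbinom p k = (\prod_(i < k) (p + i%:R)) / k`!%:R.
Proof. by rewrite /negbinom locked_withE. Qed.

Lemma negbinom0 p : negbinom p 0 = 1.
Proof. by rewrite !negbinomE big_ord0 fact0 divr1. Qed.

Lemma negbinomS p k : k.+1%:R * negbinom p k.+1 = (p + k%:R) * negbinom p k.
Proof.
have kf : (k`!%:R : R) != 0 by rewrite pnatr_eq0 -lt0n fact_gt0.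
have k1 : (k.+1%:R : R) != 0 by rewrite pnatr_eq0.
rewrite !negbinomE big_ord_recr/= factS natrM; field.
by rewrite kf nat1r k1.
Qed.

(** Coefficient form of the fact that (1 - x)^(-p) has derivative p (1 - x)^(-(p + 1)). *)
Lemma negbinomSD1 p k : k.+1%:R * negbinom p k.+1 = p * negbinom (p + 1) k.
Proof.
have kf : (k`!%:R : R) != 0 by rewrite pnatr_eq0 -lt0n fact_gt0.
have k1 : (k.+1%:R : R) != 0 by rewrite pnatr_eq0.
rewrite !negbinomE big_ord_recl/= addr0 factS natrM.
under eq_bigr => i _ do rewrite /bump/= add1n -natr1 [_ + 1]addrC addrA.
by field; rewrite kf nat1r k1.
Qed.

Lemma negbinomD1 p k : p * negbinom (p + 1) k = (p + k%:R) * negbinom p k.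
Proof. by rewrite -negbinomSD1 negbinomS. Qed.

Lemma negbinom_ge0 p k : 0 < p -> 0 <= negbinom p k.
Proof.
move=> p0; rewrite negbinomE divr_ge0// prodr_ge0// => i _.
by rewrite addr_ge0// ltW.
Qed.

Lemma gbinomN p k : gbinom (- p) k = (- 1) ^+ k * negbinom p k.
Proof.
rewrite /gbinom negbinomE mulrA; congr (_ / _).
under eq_bigr => i _ do rewrite -opprD -mulN1r.
by rewrite big_split/= prodr_const card_ord.
Qed.

Definition negbinom_sum p n x : R := \sum_(k < n) negbinom p k * x ^+ k.

(** By [negbinomS] the full series S satisfies (1 - x) S' = p S. Truncation leaves a single boundary
    term, which for [n = 0] vanishes through its factor [n%:R]. *)
Lemma is_derive_negbinom_sum p n x : x < 1 ->
  is_derive x 1 (negbinom_sum p n)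
    ((p * negbinom_sum p n x - n%:R * negbinom p n * x ^+ n.-1) / (1 - x)).
Proof.
move=> x1; have x1' : 1 - x != 0 by rewrite subr_eq0 gt_eqF.
elim: n => [|n IH].
  have -> : negbinom_sum p 0 = cst 0.
    by apply/funext => z; rewrite /negbinom_sum big_ord0.
  by apply: is_derive_eq; rewrite mulr0 mul0r mul0r subrr mul0r.
have -> : negbinom_sum p n.+1 =
    negbinom_sum p n + (negbinom p n \*: (fun z : R => z ^+ n)).
  by apply/funext => z; rewrite /negbinom_sum big_ord_recr.
have dX : is_derive x 1 (fun z : R => z ^+ n) (n%:R * x ^+ n.-1).
  have := @is_deriveX _ _ (@id R) n x 1 1 (is_derive_id _ _).
  rewrite /GRing.scale/= mulr1 (_ : id ^+ n = fun z => z ^+ n)//.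
  exact: exprfctE.
have := is_deriveD IH (is_deriveZ (negbinom p n) dX).
move=> D; apply: (is_derive_eq D).
rewrite !fctE/= negbinomS /GRing.scale/=.
by case: n {IH dX D} => [|n] /=; [rewrite !mul0r expr0|rewrite exprS]; field.
Qed.

(* Only the last term survives in the derivative, which yields both the bound for
   [0 <= x] and the convergence to the binomial function. *)
Lemma is_derive_negbinom_sum_powR p n x : 0 < p -> x < 1 ->
  is_derive x 1 (fun z => negbinom_sum p n z * (1 - z) `^ p)
    (- (n%:R * negbinom p n * x ^+ n.-1 * (1 - x) `^ (p - 1))).
Proof.
move=> p0 x1; have x1' : 0 < 1 - x by rewrite subr_gt0.
have d1 := is_derive_negbinom_sum p n x1.
have d2 : is_derive x 1 (fun z => (1 - z) `^ p) (- (p * (1 - x) `^ (p - 1))).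
  have dB : is_derive x 1 (fun z : R => 1 - z) (- 1).
    by rewrite -[- 1]sub0r; apply: is_deriveB.
  have dP : is_derive (1 - x) 1 (fun z => z `^ p) (p * (1 - x) `^ (p - 1)).
    exact: is_derive1_powR.
  apply: (is_derive_eq
    (@is_derive1_comp _ (fun z => z `^ p) (fun z => 1 - z) _ _ _ dP dB)).
  by rewrite mulrN1.
have := is_deriveM d1 d2; move=> D; apply: (is_derive_eq D).
rewrite /GRing.scale/= -[(1 - x) `^ p](mulr_powRB1 (ltW x1') p0).
by field; rewrite gt_eqF.
Qed.

Lemma negbinom_sum0 p n : negbinom_sum p n.+1 0 = 1.
Proof.
rewrite /negbinom_sum big_ord_recl expr0 mulr1 negbinom0 big1 ?addr0// => i _.
by rewrite exprS mul0r mulr0.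
Qed.

(** Multiplied by (1 - z)^p, the partial sum equals 1 at 0 and has nonpositive derivative on [0, 1[,
    so the mean value theorem keeps it at most 1. *)
Lemma negbinom_sum_le p n x : 0 < p -> 0 <= x < 1 ->
  negbinom_sum p n x <= (1 - x) `^ (- p).
Proof.
move=> p0 /andP[x0 x1]; have x1' : 0 < 1 - x by rewrite subr_gt0.
case: n => [|n]; first by rewrite /negbinom_sum big_ord0 powR_ge0.
move: x0; rewrite le_eqVlt => /predU1P[<-|x0].
  by rewrite negbinom_sum0 subr0 powR1.
have [||c] := @MVT R (fun z => negbinom_sum p n.+1 z * (1 - z) `^ p)
  (fun z => - (n.+1%:R * negbinom p n.+1 * z ^+ n * (1 - z) `^ (p - 1))) 0 x x0.
- move=> c; rewrite in_itv/= => /andP[_ cx].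
  by apply: is_derive_negbinom_sum_powR => //; exact: lt_trans x1.
- apply: derivable_within_continuous => c; rewrite in_itv/= => /andP[_ cx].
  have [] // := @is_derive_negbinom_sum_powR p n.+1 c p0.
  exact: le_lt_trans x1.
rewrite in_itv/= => /andP[c0 cx].
rewrite negbinom_sum0 subr0 powR1 mulr1 => E.
have {E} : negbinom_sum p n.+1 x * (1 - x) `^ p <= 1.
  rewrite -subr_le0 E subr0 mulNr oppr_le0.
  rewrite mulr_ge0 ?(ltW x0)// mulr_ge0 ?powR_ge0// mulr_ge0//.
    by rewrite mulr_ge0 ?negbinom_ge0.
  by rewrite exprn_ge0 ?(ltW c0).
by rewrite -ler_pdivlMr ?powR_gt0// powRN div1r.
Qed.

Lemma is_cvg_negbinom_series p x : 0 < p -> 0 <= x < 1 ->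
  cvgn (series (fun k => negbinom p k * x ^+ k)).
Proof.
move=> p0 x01; apply: nondecreasing_is_cvgn.
  apply/nondecreasing_seqP => n; rewrite -subr_ge0 seriesSB.
  by rewrite mulr_ge0 ?negbinom_ge0// exprn_ge0//; case/andP: x01.
exists ((1 - x) `^ (- p)) => _ [n _ <-].
by rewrite /series/= big_mkord; exact: negbinom_sum_le.
Qed.

(** By the mean value theorem on [-x, 0], the product of the partial sum and (1 + x)^p differs from
    1 by at most a constant times a term of the convergent series for [p + 1]; such terms tend to
    0. *)
Lemma cvg_negbinom_sum p x : 0 < p -> 0 <= x < 1 ->
  negbinom_sum p n (- x) @[n --> \oo] --> (1 + x) `^ (- p).
Proof.
move=> p0 /andP[x0 x1].
have x1' : 0 < 1 + x by rewrite ltr_wpDr.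
(* The empty sum [negbinom_sum p 0] is not 1 at the origin, so the estimate starts at index 1. *)
rewrite -cvg_shiftS/=.
have cv0 : p * (negbinom (p + 1) n * x ^+ n) @[n --> \oo] --> (0 : R).
  rewrite -(mulr0 p); apply: cvgM; first exact: cvg_cst.
  apply: (@cvg_series_cvg_0 _ R^o); apply: is_cvg_negbinom_series.
    by rewrite addr_gt0.
  by rewrite x0.
have bd n : `|negbinom_sum p n.+1 (- x) * (1 + x) `^ p - 1| <=
    (1 + x) `^ p * (p * (negbinom (p + 1) n * x ^+ n)).
  move: (x0); rewrite le_eqVlt => /predU1P[<-|x0'].
    rewrite oppr0 negbinom_sum0 addr0 powR1 mulr1 subrr normr0 mul1r.
    by rewrite mulr_ge0 ?(ltW p0)// mulr_ge0 ?negbinom_ge0 ?addr_gt0.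
  have Nx0 : - x < 0 by rewrite oppr_lt0.
  have [||c] := @MVT R (fun z => negbinom_sum p n.+1 z * (1 - z) `^ p)
    (fun z => - (n.+1%:R * negbinom p n.+1 * z ^+ n * (1 - z) `^ (p - 1)))
    (- x) 0 Nx0.
  - move=> c; rewrite in_itv/= => /andP[_ cx].
    by apply: is_derive_negbinom_sum_powR => //; exact: lt_trans cx _.
  - apply: derivable_within_continuous => c; rewrite in_itv/= => /andP[_ cx].
    have [] // := @is_derive_negbinom_sum_powR p n.+1 c p0.
    exact: le_lt_trans cx _.
  rewrite in_itv/= => /andP[c0 cx].
  rewrite negbinom_sum0 subr0 powR1 mulr1 !opprK add0r => E.
  rewrite distrC E negbinomSD1 !normrM normrN !normrM.
  rewrite (ger0_norm (ltW p0)) (ger0_norm x0) (ger0_norm (powR_ge0 _ _)).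
  rewrite (@ger0_norm _ (negbinom _ _)) ?negbinom_ge0 ?addr_gt0//.
  rewrite normrX ltr0_norm//.
  have c1 : 1 <= 1 - c by rewrite lerDl oppr_ge0 ltW.
  (* Here 1 <= 1 - c <= 1 + x. The exponent is first raised to [p], because [p - 1] may be negative
     and the power then not monotone in the required direction. *)
  have h1 : (1 - c) `^ (p - 1) <= (1 + x) `^ p.
    apply: (@le_trans _ _ ((1 - c) `^ p)).
      by apply: ler_powR => //; rewrite gerBl.
    by apply: ge0_ler_powR; rewrite ?nnegrE ?(ltW p0)//; lra.
  have h2 : (- c) ^+ n <= x ^+ n by apply: lerXn2r; rewrite ?nnegrE; lra.
  have B0 : 0 <= p * negbinom (p + 1) n.
    by rewrite mulr_ge0 ?negbinom_ge0 ?addr_gt0// ltW.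
  rewrite -[leRHS]mulr1; apply: ler_pM => //; last exact: ltW.
    rewrite mulr_ge0 ?powR_ge0// mulr_ge0// exprn_ge0//.
    by rewrite oppr_ge0 ltW.
  rewrite [leRHS]mulrC; apply: ler_pM; rewrite ?powR_ge0//.
    by rewrite mulr_ge0// exprn_ge0// oppr_ge0 ltW.
  by rewrite mulrA; apply: ler_wpM2l.
have cv1 : negbinom_sum p n.+1 (- x) * (1 + x) `^ p @[n --> \oo] --> (1 : R).
  apply/cvgrPdist_le => e e0.
  have : (1 + x) `^ p * (p * (negbinom (p + 1) n * x ^+ n)) @[n --> \oo]
      --> (0 : R).
    by rewrite -(mulr0 ((1 + x) `^ p)); apply: cvgM; first exact: cvg_cst.
  move=> /cvgrPdist_le /(_ _ e0); apply: filterS => n; rewrite sub0r normrN => h.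
  by rewrite distrC (le_trans (bd n))// (le_trans (ler_norm _)).
have -> : (fun n => negbinom_sum p n.+1 (- x)) =
    (fun n => negbinom_sum p n.+1 (- x) * (1 + x) `^ p * (1 + x) `^ (- p)).
  by apply/funext => n; rewrite powRN mulfK// gt_eqF// powR_gt0.
have cv2 := cvgMr_tmp (b := (1 + x) `^ (- p)) cv1.
by rewrite mul1r in cv2; exact: cv2.
Qed.

End NegativeBinomial.

(** * The alternating series behind the Polya density, and its absolute convergence *)

Section PolyaSeries.
Variable R : realType.
Implicit Types (p t : R) (k n : nat).

(** With [p = a + b], this is the absolute value of the Polya weight, times B(a, b). *)
Definition polya_coef p k : R := negbinom p k * (p / 2 + k%:R).

Lemma polya_coef_ge0 p k : 0 < p -> 0 <= polya_coef p k.
Proof.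
by move=> p0; rewrite mulr_ge0 ?negbinom_ge0// addr_ge0// divr_ge0// ltW.
Qed.

Definition polya_term p t k : R :=
  (- 1) ^+ k * (polya_coef p k * expR (- ((p / 2 + k%:R) ^+ 2 * t))).

Lemma normr_polya_term p t k : 0 < p ->
  `|polya_term p t k| = polya_coef p k * expR (- ((p / 2 + k%:R) ^+ 2 * t)).
Proof.
move=> p0; rewrite normrM normrX normrN normr1 expr1n mul1r ger0_norm//.
by rewrite mulr_ge0 ?polya_coef_ge0// expR_ge0.
Qed.

(** Comparison with a binomial series: p/2 + k <= p + k turns the coefficient into that of exponent
    [p + 1], and (p/2 + k)^2 >= k p/2 bounds the Gaussian factor by the geometric one x^k. *)
Lemma is_cvg_series_normr_polya_term p t : 0 < p -> 0 < t ->
  cvgn [normed series (polya_term p t)].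
Proof.
move=> p0 t0; pose x : R := expR (- (p / 2 * t)).
have x01 : 0 <= x < 1.
  by rewrite expR_ge0 -expR0 ltr_expR oppr_lt0 mulr_gt0// divr_gt0.
apply: (@series_le_cvg _ _ (fun k => p * (negbinom (p + 1) k * x ^+ k))).
- by move=> n; exact: normr_ge0.
- move=> n; rewrite mulr_ge0 ?(ltW p0)// mulr_ge0//.
    by rewrite negbinom_ge0// addr_gt0.
  by rewrite exprn_ge0// expR_ge0.
- move=> n; rewrite /= normr_polya_term// mulrA negbinomD1.
  rewrite [(p + _) * _]mulrC; apply: ler_pM.
  + exact: polya_coef_ge0.
  + exact: expR_ge0.
  + by rewrite /polya_coef ler_wpM2l ?negbinom_ge0//; lra.
  + rewrite /x -expRM_natl ler_expR mulrN lerN2 mulrA ler_wpM2r ?(ltW t0)//.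
    have n0 : (0 : R) <= n%:R by [].
    by nra.
- have cn : cvgn (series (fun k => negbinom (p + 1) k * x ^+ k)).
    by apply: is_cvg_negbinom_series => //; rewrite addr_gt0.
  exact: (is_cvg_seriesZ (k := p) cn).
Qed.

Lemma is_cvg_series_polya_term p t : 0 < p -> 0 < t ->
  cvgn (series (polya_term p t)).
Proof.
by move=> p0 t0; apply: normed_cvg; exact: is_cvg_series_normr_polya_term.
Qed.

End PolyaSeries.

(** * Nonnegativity of the series, through hypoexponential densities *)

Section PolyaNonneg.
Variable R : realType.
Implicit Types (p t : R) (k n m : nat).

(* The coefficients of the hypoexponential density with rates
   (p / 2 + k) ^ 2, k <= n, are, up to a common positive factor, those of
   [polya_term] times these factors, which vanish for k > n. *)
Definition damping p n k : R :=
  \prod_(j < k) ((n%:R - j%:R) / (p + n.+1%:R + j%:R)).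

Lemma damping_itv p n k : 0 < p -> (k <= n)%N -> 0 <= damping p n k <= 1.
Proof.
move=> p0 kn.
have f01 (j : 'I_k) : 0 <= (n%:R - j%:R) / (p + n.+1%:R + j%:R) <= (1 : R).
  have jn : (j%:R : R) <= n%:R by rewrite ler_nat (leq_trans (ltnW (ltn_ord j))).
  have j0 : (0 : R) <= j%:R by [].
  have d0 : 0 < p + n.+1%:R + j%:R by rewrite -natr1; lra.
  rewrite divr_ge0 ?subr_ge0 ?(ltW d0)//= ler_pdivrMr// mul1r -natr1; lra.
apply/andP; split; first by apply: prodr_ge0 => j _; case/andP: (f01 j).
by apply: prodr_ile1 => j _; exact: f01.
Qed.

(** The difference of squares factors as (n + 1 - k) (p + n + 1 + k), which is what the ratio of
    consecutive dampings contributes. It matches the coefficients in the differential equation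
    linking [polya_trunc p n.+1] to [polya_trunc p n]. *)
Lemma dampingS p n k : 0 < p ->
  ((p / 2 + n.+1%:R) ^+ 2 - (p / 2 + k%:R) ^+ 2) * damping p n.+1 k =
  n.+1%:R * (p + n.+1%:R) * damping p n k.
Proof.
move=> p0; elim: k => [|k IH].
  by rewrite /damping !big_ord0 !mulr1; field.
have k0 : (0 : R) <= k%:R by [].
have n0 : (0 : R) <= n%:R by [].
rewrite /damping !big_ord_recr -/(damping p n k) -/(damping p n.+1 k)/=.
rewrite [RHS]mulrA -{}IH -!natr1.
by field; rewrite !gt_eqF//; lra.
Qed.

(* The right-hand side vanishes for m = n > 0: the density of a sum of at least two
   independent exponential variables is 0 at the origin. *)
Lemma sum_polya_coef_damping p n m : 0 < p ->
  \sum_(k < m.+1) (- 1) ^+ k * (polya_coef p k * damping p n k) =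
  p / 2 * (- 1) ^+ m * negbinom (p + 1) m *
    \prod_(j < m) ((n%:R - 1 - j%:R) / (p + n.+1%:R + j%:R)).
Proof.
move=> p0; elim: m => [|m IH].
  rewrite big_ord_recl !big_ord0 /polya_coef /damping/= big_ord0 !negbinom0.
  by ring.
have dampS : damping p n m.+1 = n%:R / (p + n.+1%:R + m%:R) *
    \prod_(j < m) ((n%:R - 1 - j%:R) / (p + n.+1%:R + j%:R)).
  rewrite /damping !big_split/= big_ord_recl subr0 [X in _ * X = _]big_ord_recr/=.
  rewrite [RHS]mulrACA [X in _ = _ * X]mulrC; congr (_ * _ * _).
  by apply: eq_bigr => j _; rewrite /bump/= add1n -natr1 opprD addrA addrAC.
rewrite big_ord_recr/= IH dampS /polya_coef.
have n0 : (0 : R) <= n%:R by [].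
have m0 : (0 : R) <= m%:R by [].
have m1 : (0 : R) < m.+1%:R by [].
have -> : negbinom p m.+1 = p * negbinom (p + 1) m / m.+1%:R.
  by rewrite -negbinomSD1 mulrAC divff ?mul1r// gt_eqF.
have -> : negbinom (p + 1) m.+1 = (p + 1 + m%:R) * negbinom (p + 1) m / m.+1%:R.
  by rewrite -negbinomS mulrAC divff ?mul1r// gt_eqF.
rewrite [in RHS]big_ord_recr/= !exprS -!natr1.
by field; rewrite !gt_eqF//; lra.
Qed.

Definition polya_trunc p n t : R :=
  \sum_(k < n.+1) damping p n k * polya_term p t k.

Lemma polya_truncS0 p n : 0 < p -> polya_trunc p n.+1 0 = 0.
Proof.
move=> p0; transitivity (\sum_(k < n.+2)
    (- 1) ^+ k * (polya_coef p k * damping p n.+1 k)).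
  apply: eq_bigr => k _.
  by rewrite /polya_term mulr0 oppr0 expR0; ring.
rewrite sum_polya_coef_damping// big_ord_recr/=.
have -> : n.+1%:R - 1 - n%:R = 0 :> R by rewrite -natr1; ring.
by rewrite mul0r !mulr0.
Qed.

Lemma is_derive_polya_term p k t : is_derive t 1 (fun s => polya_term p s k)
  (- (p / 2 + k%:R) ^+ 2 * polya_term p t k).
Proof.
pose c : R := - (p / 2 + k%:R) ^+ 2.
have dc : is_derive t 1 (c \*: (@id R)) (c *: 1).
  exact: is_deriveZ.
have de := @is_derive1_comp _ _ _ _ _ _ (is_derive_expR (c * t)) dc.
have := is_deriveZ ((- 1) ^+ k * polya_coef p k) de.
have -> : ((-1) ^+ k * polya_coef p k) \*: (expR \o (c \*: @id R)) =
    (fun s => polya_term p s k).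
  by apply/funext => s; rewrite /polya_term -mulNr [RHS]mulrA.
move=> D; apply: (is_derive_eq D).
by rewrite /polya_term /c /GRing.scale/= mulNr; ring.
Qed.

(* The equation h' + c^2 h = K h_n, K > 0, of a convolution with an exponential
   density of rate c^2, in integrating factor form. *)
Lemma is_derive_polya_truncS p n t : 0 < p ->
  is_derive t 1
    (fun s => expR ((p / 2 + n.+1%:R) ^+ 2 * s) * polya_trunc p n.+1 s)
    (expR ((p / 2 + n.+1%:R) ^+ 2 * t) *
      (n.+1%:R * (p + n.+1%:R) * polya_trunc p n t)).
Proof.
move=> p0; pose c : R := (p / 2 + n.+1%:R) ^+ 2.
have dc : is_derive t 1 (c \*: (@id R)) (c *: 1) by exact: is_deriveZ.
have de := @is_derive1_comp _ _ _ _ _ _ (is_derive_expR (c * t)) dc.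
have ds : is_derive t 1 (polya_trunc p n.+1) (\sum_(k < n.+2)
    damping p n.+1 k *: (- (p / 2 + k%:R) ^+ 2 * polya_term p t k)).
  have := @is_derive_sum _ _ _ n.+2
    (fun (k : 'I_n.+2) (s : R) => damping p n.+1 k *: polya_term p s k) t 1
    (fun k : 'I_n.+2 => damping p n.+1 k *: (- (p / 2 + k%:R) ^+ 2 * polya_term p t k)).
  rewrite fct_sumE; apply => k.
  exact: (is_deriveZ _ (is_derive_polya_term p k t)).
move: (is_deriveM de ds) => D; apply: (is_derive_eq D).
rewrite /GRing.scale/= -/c; set S := \sum_(_ < _) _.
transitivity (expR (c * t) * (S + c * polya_trunc p n.+1 t)).
  by rewrite mulr1; ring.
congr (_ * _); rewrite /S /polya_trunc !mulr_sumr -big_split/= big_ord_recr/=.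
(* The term [k = n.+1] drops out: its decay rate is exactly the rate [c] of the integrating
   factor. *)
rewrite [X in _ + X](_ : _ = 0) ?addr0; last by rewrite /c; ring.
apply: eq_bigr => k _.
by rewrite [RHS]mulrA -dampingS// -/c; ring.
Qed.

(** Induction on [n]: multiplied by the integrating factor, the next truncation vanishes at 0 and
    has a derivative that is nonnegative by the induction hypothesis. *)
Lemma polya_trunc_ge0 p n t : 0 < p -> 0 <= t -> 0 <= polya_trunc p n t.
Proof.
move=> p0; elim: n t => [|n IH] t t0.
  rewrite /polya_trunc big_ord_recl big_ord0 addr0 /damping big_ord0 mul1r.
  by rewrite /polya_term expr0 mul1r mulr_ge0 ?polya_coef_ge0// expR_ge0.
move: t0; rewrite le_eqVlt => /predU1P[<-|t0]; first by rewrite polya_truncS0.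
pose D s : R := expR ((p / 2 + n.+1%:R) ^+ 2 * s) *
  (n.+1%:R * (p + n.+1%:R) * polya_trunc p n s).
have [||s] := @MVT R
  (fun s => expR ((p / 2 + n.+1%:R) ^+ 2 * s) * polya_trunc p n.+1 s) D 0 t t0.
- by move=> s _; exact: is_derive_polya_truncS.
- apply: derivable_within_continuous => s _.
  by have [] := is_derive_polya_truncS n s p0.
rewrite in_itv/= => /andP[s0 st].
rewrite polya_truncS0// mulr0 !subr0 => E.
rewrite -(pmulr_rge0 _ (expR_gt0 ((p / 2 + n.+1%:R) ^+ 2 * t))) E.
rewrite mulr_ge0 ?(ltW t0)// mulr_ge0 ?expR_ge0// mulr_ge0 ?IH ?(ltW s0)//.
by rewrite mulr_ge0// addr_ge0// ltW.
Qed.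

Let cvgn_eq (u : nat -> R) (l l' : R) : u @ \oo --> l' -> l' = l ->
  u @ \oo --> l.
Proof. by move=> + <-. Qed.

Lemma cvg_damping p k : 0 < p -> damping p n k @[n --> \oo] --> (1 : R).
Proof.
move=> p0; elim: k => [|k IH].
  rewrite /damping; under eq_fun do rewrite big_ord0; exact: cvg_cst.
rewrite /damping; under eq_fun do rewrite big_ord_recr/=.
apply: cvgn_eq (mulr1 1); apply: cvgM; first exact: IH.
(* Written as 1 minus a constant over p + n + 1 + k, the factor tends to 1 by comparison with the
   harmonic sequence. *)
have -> : (fun n => (n%:R - k%:R) / (p + n.+1%:R + k%:R)) =
    (fun n => 1 - (p + 1 + k%:R + k%:R) * (p + n.+1%:R + k%:R)^-1) :> (nat -> R).
  apply/funext => n.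
  have k0 : (0 : R) <= k%:R by [].
  have n0 : (0 : R) <= n%:R by [].
  by rewrite -natr1; field; rewrite gt_eqF//; lra.
apply: cvgn_eq (subr0 1); apply: cvgB; first exact: cvg_cst.
apply: cvgn_eq (mulr0 (p + 1 + k%:R + k%:R)); apply: cvgM; first exact: cvg_cst.
apply: (@squeeze_cvgr _ _ _ _ (cst 0) harmonic); last 2 first.
- exact: cvg_cst.
- exact: cvg_harmonic.
apply: nearW => n.
have d0 : 0 < p + n.+1%:R + k%:R by rewrite ltr_wpDr// ltr_wpDr.
rewrite invr_ge0 (ltW d0)/= lef_pV2 ?posrE//.
by rewrite -addrA addrCA lerDl addr_ge0// ltW.
Qed.

(* Tannery's theorem: below a fixed index m the dampings tend to 1, and above it
   the damped sum is controlled by the tail of the absolutely convergent series. *)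
Lemma polya_series_ge0 p t : 0 < p -> 0 < t ->
  0 <= limn (series (polya_term p t)).
Proof.
move=> p0 t0; pose s := polya_term p t; pose a k := `|s k|.
have ca : cvgn (series a) by exact: is_cvg_series_normr_polya_term.
have cs : cvgn (series s) by exact: is_cvg_series_polya_term.
pose A := limn (series a).
have aA m : series a m <= A.
  apply: nondecreasing_cvgn_le => //; apply/nondecreasing_seqP => n.
  by rewrite -subr_ge0 seriesSB /a normr_ge0.
have bnd m : 0 <= series s m + (A - series a m).
  have cv : \sum_(k < m) damping p n k * s k + (A - series a m) @[n --> \oo] -->
      series s m + (A - series a m).
    apply: cvgD; last exact: cvg_cst.
    rewrite /series/= big_mkord.
    apply: (@cvgn_eq _ _ (\sum_(k < m) 1 * s k)); last first.
      by apply: eq_bigr => k _; rewrite mul1r.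
    apply: cvg_big => [|k _]; first exact: add_continuous.
    by apply: cvgMr_tmp; exact: cvg_damping.
  rewrite -(cvg_lim _ cv)//; apply: limr_ge.
    by apply/cvg_ex; eexists; exact: cv.
  exists m => // n /= mn.
  apply: (le_trans (polya_trunc_ge0 n p0 (ltW t0))).
  rewrite /polya_trunc -(big_mkord xpredT (fun k => damping p n k * s k)).
  rewrite -(big_mkord xpredT (fun k => damping p n k * s k)).
  rewrite (big_cat_nat (n := m))//= ?(leq_trans mn)// lerD2l.
  apply: (@le_trans _ _ (series a n.+1 - series a m)); last by rewrite lerB.
  rewrite sub_series_geq ?(leq_trans mn)//.
  rewrite big_nat_cond [leRHS]big_nat_cond; apply: ler_sum => k /andP[/andP[_ kn] _].
  have /andP[d0 d1] := damping_itv p0 (kn : (k <= n)%N).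
  apply: (le_trans (ler_norm _)); rewrite normrM ger0_norm//.
  by rewrite ler_piMl.
(* As [m] grows the tail [A - series a m] tends to 0, so the bounds [bnd] pass to the limit. *)
have cv : series s m + (A - series a m) @[m --> \oo] --> limn (series s) + (A - A).
  by apply: cvgD => //; apply: cvgB => //; exact: cvg_cst.
rewrite subrr addr0 in cv.
rewrite -/s -(cvg_lim _ cv)//; apply: limr_ge.
  by apply/cvg_ex; eexists; exact: cv.
exact: nearW.
Qed.

End PolyaNonneg.

(** * The fundamental theorem of calculus on an increasing union of compact intervals *)

Section ImproperFTC.
Variable R : realType.
Notation mu := (@lebesgue_measure R).

(** Monotone convergence along the intervals, on each of which the usual theorem applies. It serves
    integrands that may be singular at both ends of the domain. *)
Lemma ge0_FTC_exhaustion (f F : R -> R) (D : set R) (u v : nat -> R) (A B : R) :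
  (forall n, u n < v n) -> nonincreasing_seq u -> nondecreasing_seq v ->
  \bigcup_n `[u n, v n]%classic = D ->
  (forall x, D x -> 0 <= f x) ->
  (forall x, D x -> {for x, continuous f}) ->
  (forall x, D x -> is_derive x 1 F (f x)) ->
  F (u n) @[n --> \oo] --> A -> F (v n) @[n --> \oo] --> B ->
  (\int[mu]_(x in D) (f x)%:E = (B - A)%:E)%E.
Proof.
move=> uv nu nv DE f0 cf dF FA FB.
have sD n x : `[u n, v n]%classic x -> D x by move=> h; rewrite -DE; exists n.
have wcf n : {within `[u n, v n], continuous f}.
  by apply: continuous_in_subspaceT => x /[!inE] /sD; exact: cf.
have cv : (\int[mu]_(x in `[u n, v n]) (f x)%:E @[n --> \oo] -->
    \int[mu]_(x in D) (f x)%:E)%E.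
  rewrite -DE; apply: ge0_nondecreasing_set_cvg_integral => //=.
  - move=> m n mn; apply/subsetPset/subset_itv; rewrite bnd_simp.
      exact: nu.
    exact: nv.
  - move=> n; apply/measurable_EFinP.
    by apply: subspace_continuous_measurable_fun.
  - by move=> n x /sD Dx; rewrite lee_fin f0.
have cv' : (\int[mu]_(x in `[u n, v n]) (f x)%:E @[n --> \oo] --> (B - A)%:E)%E.
  have -> : (fun n => \int[mu]_(x in `[u n, v n]) (f x)%:E)%E =
      (fun n => (F (v n) - F (u n))%:E).
    apply/funext => n; rewrite (@continuous_FTC2 _ f F) ?EFinB//.
      have wcF : {within `[u n, v n], continuous F}.
        by apply: derivable_within_continuous => x /sD /dF[].
      have [_ ? ?] := (continuous_within_itvP _ (uv n)).1 wcF.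
      split => // x xuv; have : D x by apply: (sD n); exact: subset_itv_oo_cc xuv.
      by move=> /dF[].
    move=> x xuv; have : D x by apply: (sD n); exact: subset_itv_oo_cc xuv.
    by move=> /dF[_]; rewrite derive1E.
  by apply: cvg_EFin; [exact: nearW|exact: cvgB].
exact: cvg_unique cv cv'.
Qed.

End ImproperFTC.

(** * The standard normal distribution function *)

Section GaussCdf.
Variable R : realType.
Notation mu := (@lebesgue_measure R).
Let P := @normal_prob R 0 1.
(** The identity as a random variable under the standard normal law: its distribution function is
    [gauss_cdf], which gives the limits at both infinities. *)
Let idR : measurableTypeR R -> R := idfun.
#[local] HB.instance Definition _ := isMeasurableFun.Build _ _ _ _ idR
  (@measurable_id _ _ setT).

Definition gauss_cdf (x : R) : R := fine (P `]-oo, x]).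

Lemma cvg_gauss_cdfNy : gauss_cdf x @[x --> -oo] --> (0 : R).
Proof.
have /fine_cvgP[_] := cvg_cdfNy0 (idR : {RV P >-> R}).
by rewrite [X in X @ _ --> _ -> _](_ : _ = gauss_cdf).
Qed.

Lemma cvg_gauss_cdfy : gauss_cdf x @[x --> +oo] --> (1 : R).
Proof.
have /fine_cvgP[_] := cvg_cdfy1 (idR : {RV P >-> R}).
by rewrite [X in X @ _ --> _ -> _](_ : _ = gauss_cdf).
Qed.

Lemma is_derive_gauss_cdf (x : R) :
  is_derive x 1 gauss_cdf ((Num.sqrt (2 * pi))^-1 * expR (- (x ^+ 2 / 2))).
Proof.
have [||||dG GE] := @continuous_FTC1 R (normal_pdf 0 1) -oo%O x (x + 1).
- by rewrite ltrDl.
- by apply: (integrableS _ _ (subsetT _)) => //; exact: integrable_normal_pdf.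
- by rewrite ltNyr.
- by apply: continuous_normal_pdf; exact: oner_neq0.
have -> : (Num.sqrt (2 * pi))^-1 * expR (- (x ^+ 2 / 2)) = normal_pdf 0 1 x.
  rewrite normal_pdfE ?oner_neq0// /normal_peak /normal_fun expr1n subr0 mul1r.
  by rewrite -[pi *+ 2]mulr_natl mulNr.
by split; [exact: dG|rewrite -derive1E; exact: GE].
Qed.

End GaussCdf.

(** * The heat kernel: the centred normal density of variance x, at the point m *)

Section Heat.
Variables (R : realType) (m : R).

Definition heat (x : R) : R :=
  (Num.sqrt (2 * pi * x))^-1 * expR (- (m ^+ 2 / (2 * x))).

Lemma heat_ge0 x : 0 <= heat x.
Proof. by rewrite mulr_ge0 ?expR_ge0// invr_ge0 sqrtr_ge0. Qed.

Lemma continuous_heat x : 0 < x -> {for x, continuous heat}.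
Proof.
move=> x0; apply: cvgM.
  apply: cvgV; first by rewrite gt_eqF// sqrtr_gt0 !mulr_gt0 ?pi_gt0.
  apply: continuous_cvg; first exact: sqrt_continuous.
  by apply: cvgM; [exact: cvg_cst|exact: cvg_id].
apply: continuous_cvg; first exact: continuous_expR.
apply: cvgN; apply: cvgM; first exact: cvg_cst.
apply: cvgV; first by rewrite gt_eqF// mulr_gt0.
by apply: cvgM; [exact: cvg_cst|exact: cvg_id].
Qed.

Lemma measurable_heat : measurable_fun (`]0, +oo[ : set R) heat.
Proof.
apply: open_continuous_measurable_fun; first exact: interval_open.
by move=> x /set_mem; rewrite /= in_itv/= andbT; exact: continuous_heat.
Qed.

End Heat.

(** * The Laplace transform of the heat kernel in the time variable *)

Section InverseGaussian.
Variable R : realType.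
Notation mu := (@lebesgue_measure R).
Variables (m c : R).
Hypotheses (m0 : 0 < m) (c0 : 0 < c).

Definition ig_fun (x : R) : R := heat m x * expR (- (c ^+ 2 * (x / 2))).

(* The squares of the two arguments of [gauss_cdf] have the cross terms
   -2 c m and 2 c m, which the exponential weights cancel; the weighted derivatives
   then add up to [c * ig_fun]. *)
Definition ig_prim (x : R) : R := c^-1 *
  (expR (- (c * m)) * gauss_cdf (c * Num.sqrt x - m / Num.sqrt x)
   + expR (c * m) * gauss_cdf (c * Num.sqrt x + m / Num.sqrt x)).

Lemma is_derive_ig_prim (x : R) : 0 < x -> is_derive x 1 ig_prim (ig_fun x).
Proof.
move=> x0; have s0 : 0 < Num.sqrt x by rewrite sqrtr_gt0.
have ds : is_derive x 1 Num.sqrt (2 * Num.sqrt x)^-1 := is_derive1_sqrt x0.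
have dV : is_derive x 1 (fun z => (Num.sqrt z)^-1)
    (- (Num.sqrt x) ^- 2 * (2 * Num.sqrt x)^-1).
  by have := is_deriveV (lt0r_neq0 s0) ds.
have dA : is_derive x 1 (fun z => c * Num.sqrt z)
    (c * (2 * Num.sqrt x)^-1) := is_deriveZ c ds.
have dB : is_derive x 1 (fun z => m / Num.sqrt z)
    (m * (- (Num.sqrt x) ^- 2 * (2 * Num.sqrt x)^-1)) := is_deriveZ m dV.
have dC k z f df : is_derive x 1 f df -> f x = z -> is_derive x 1
    (fun y => k * gauss_cdf (f y))
    (k * ((Num.sqrt (2 * pi))^-1 * expR (- (z ^+ 2 / 2)) * df)).
  move=> D fx; apply: (is_deriveZ k).
  apply: (@is_derive1_comp _ (@gauss_cdf R) f) => //.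
  by rewrite fx; exact: is_derive_gauss_cdf.
have := is_deriveZ c^-1 (is_deriveD
  (dC (expR (- (c * m))) (c * Num.sqrt x - m / Num.sqrt x) _ _ (is_deriveB dA dB) erefl)
  (dC (expR (c * m)) (c * Num.sqrt x + m / Num.sqrt x) _ _ (is_deriveD dA dB) erefl)).
move=> D; apply: (is_derive_eq D) => {D}.
rewrite /ig_fun /heat /GRing.scale/=.
rewrite (sqrtrM x) ?mulr_ge0 ?pi_ge0//.
have r0 : 0 < Num.sqrt (2 * pi) :> R by rewrite sqrtr_gt0 mulr_gt0 ?pi_gt0.
move: {dC ds dV dA dB} r0; set r : R := Num.sqrt (2 * pi) => r0.
have xE : x = Num.sqrt x ^+ 2 by rewrite sqr_sqrtr// ltW.
rewrite -[RHS]mulrA -expRD [in RHS]xE.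
move: s0; set s := Num.sqrt x => s0.
have eA : expR (- (m ^+ 2 / (2 * s ^+ 2)) - c ^+ 2 * (s ^+ 2 / 2)) =
    expR (- (c * m)) * expR (- ((c * s - m / s) ^+ 2 / 2)).
  by rewrite -expRD; congr expR; field; rewrite gt_eqF.
have eB : expR (- (m ^+ 2 / (2 * s ^+ 2)) - c ^+ 2 * (s ^+ 2 / 2)) =
    expR (c * m) * expR (- ((c * s + m / s) ^+ 2 / 2)).
  by rewrite -expRD; congr expR; field; rewrite gt_eqF.
rewrite sqrtr_sqr gtr0_norm//.
move: eA eB; set E := expR (_ - _); set A := expR _; set a := expR _.
set B := expR (c * m); set b := expR _ => eA eB.
transitivity (c^-1 * r^-1 * (A * a * (c / (2 * s) - m * (- s ^- 2 / (2 * s)))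
    + B * b * (c / (2 * s) + m * (- s ^- 2 / (2 * s))))); first by ring.
by rewrite -eA -eB; field; rewrite !gt_eqF.
Qed.

(** At 0 the two arguments of [gauss_cdf] tend to -oo and +oo, at infinity both tend to +oo. Hence
    only the weight exp (- c m) of the first survives in the difference of the limits of
    [ig_prim]. *)
Lemma integral_ig_fun :
  (\int[mu]_(x in `]0%R, +oo[) (ig_fun x)%:E = (c^-1 * expR (- (c * m)))%:E)%E.
Proof.
(* The endpoints N^-2 and N^2 are squares, so that their roots are explicit; starting at 2 makes the
   intervals nondegenerate. *)
pose N n : R := n.+2%:R.
have N1 n : 1 < N n by rewrite ltr1n.
have N0 n : 0 < N n by exact: lt_trans (N1 n).
have sN n : Num.sqrt (N n ^+ 2) = N n by rewrite sqrtr_sqr gtr0_norm.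
have sNV n : Num.sqrt (N n ^- 2) = (N n)^-1.
  by rewrite -exprVn sqrtr_sqr gtr0_norm// invr_gt0.
have Nnd : nondecreasing_seq N by move=> n p np; rewrite ler_nat.
have Ny k : 0 < k -> k * N n @[n --> \oo] --> +oo.
  move=> k0; apply/cvgryPge => A; near=> n.
  rewrite mulrC -ler_pdivrMr//; apply: (@le_trans _ _ n%:R).
    by near: n; exact: nbhs_infty_ger.
  by rewrite ler_nat -addn2 leq_addr.
pose A := c^-1 * (expR (- (c * m)) * 0 + expR (c * m) * 1).
pose B := c^-1 * (expR (- (c * m)) * 1 + expR (c * m) * 1).
transitivity (B - A)%:E; last by congr EFin; rewrite /A /B; ring.
apply: (@ge0_FTC_exhaustion R ig_fun ig_prim _
  (fun n => N n ^- 2) (fun n => N n ^+ 2)).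
- move=> n; apply: (@lt_trans _ _ 1).
    by rewrite invf_lt1 ?exprn_gt0// exprn_egt1.
  by rewrite exprn_egt1.
- move=> n p np; rewrite lef_pV2 ?posrE ?exprn_gt0//.
  by rewrite lerXn2r ?nnegrE ?(ltW (N0 _))// Nnd.
- by move=> n p np; rewrite lerXn2r ?nnegrE ?(ltW (N0 _))// Nnd.
- apply/seteqP; split=> [x [n _]|x]; rewrite /= !in_itv/= ?andbT.
    move=> /andP[h _]; apply: lt_le_trans h; by rewrite invr_gt0 exprn_gt0.
  (* The sum x + 1/x exceeds both x and 1/x, so one index controls both endpoints. *)
  move=> x0; exists (Num.truncn (x + x^-1)) => //=; rewrite in_itv/=.
  have Nx : x + x^-1 <= N (Num.truncn (x + x^-1)).
    apply: (le_trans (ltW (truncnS_gt _))).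
    by rewrite ler_nat.
  have xV0 : 0 < x^-1 by rewrite invr_gt0.
  have N2 n : N n <= N n ^+ 2 by rewrite ler_eXnr// ltW.
  have N3 := le_trans Nx (N2 _).
  apply/andP; split; last first.
    by rewrite (@le_trans _ _ (x + x^-1))// lerDl ltW.
  rewrite -[leRHS]invrK lef_pV2 ?posrE ?exprn_gt0//.
  by rewrite (@le_trans _ _ (x + x^-1))// lerDr ltW.
- by move=> x _; rewrite mulr_ge0 ?heat_ge0 ?expR_ge0.
- move=> x; rewrite /= in_itv/= andbT => x0.
  rewrite /ig_fun; apply: cvgM; first exact: continuous_heat.
  apply: continuous_cvg; first exact: continuous_expR.
  apply: cvgN; apply: cvgM; first exact: cvg_cst.
  by apply: cvgM; [exact: cvg_id|exact: cvg_cst].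
- by move=> x; rewrite /= in_itv/= andbT; exact: is_derive_ig_prim.
- rewrite /ig_prim; apply: cvgM; first exact: cvg_cst.
  apply: cvgD; apply: cvgM; try exact: cvg_cst.
    apply: cvg_comp; last exact: cvg_gauss_cdfNy.
    apply/cvgrNyPle => y.
    have /cvgryPge /(_ (c - y)) := Ny m m0.
    apply: filterS => n h; rewrite sNV invrK lerBlDr -lerBlDl.
    apply: le_trans h; rewrite lerB//.
    by rewrite ler_piMr ?(ltW c0)// invf_le1 ?ltW.
  apply: cvg_comp; last exact: cvg_gauss_cdfy.
  apply: ger_cvgy (Ny m m0); apply: nearW => n.
  by rewrite sNV invrK lerDr mulr_ge0 ?invr_ge0 ?ltW.
- rewrite /ig_prim; apply: cvgM; first exact: cvg_cst.
  apply: cvgD; apply: cvgM; try exact: cvg_cst.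
    apply: cvg_comp; last exact: cvg_gauss_cdfy.
    apply/cvgryPge => y.
    have /cvgryPge /(_ (y + m)) := Ny c c0.
    apply: filterS => n h; rewrite sN lerBrDr (le_trans _ h)// lerD2l.
    by rewrite ler_pdivrMr// ler_peMr ?(ltW m0) ?ltW.
  apply: cvg_comp; last exact: cvg_gauss_cdfy.
  apply: ger_cvgy (Ny c c0); apply: nearW => n.
  by rewrite sN lerDl divr_ge0 ?ltW.
Unshelve. all: by end_near.
Qed.

Lemma ig_fun_ge0 x : 0 <= ig_fun x.
Proof. by rewrite mulr_ge0 ?heat_ge0 ?expR_ge0. Qed.

Lemma measurable_ig_fun : measurable_fun (`]0, +oo[ : set R) ig_fun.
Proof.
apply: measurable_funM; first exact: measurable_heat.
apply: measurable_funTS; apply: measurableT_comp => //.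
apply: measurableT_comp => //; apply: measurable_funM => //.
exact: measurable_funM.
Qed.

End InverseGaussian.

(** * Finiteness and positivity of the Beta integral *)

Section BetaPositive.
Variable R : realType.
Notation mu := (@lebesgue_measure R).
Variables a b : R.
Hypotheses (a0 : 0 < a) (b0 : 0 < b).

Let powR_bounds (p s : R) : 4^-1 <= s <= 1 ->
  4 `^ (- `|p|) <= s `^ p <= 4 `^ `|p|.
Proof.
move=> /andP[s4 s1]; have s0 : 0 < s by lra.
rewrite /powR (gt_eqF s0) (@gt_eqF _ _ 4)// !ler_expR mulNr -ler_norml normrM.
rewrite ler_wpM2l// ler0_norm ?ln_le0// lerNl -lnV ?posrE//.
by rewrite ler_ln ?posrE ?invr_gt0.
Qed.

Let beta_integrand (t : R) := t `^ (a - 1) * (1 - t) `^ (b - 1).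

Let measurable_beta_integrand :
  measurable_fun (`]0, 1[ : set R) (EFin \o beta_integrand).
Proof.
apply/measurable_EFinP; apply: measurable_funTS; apply: measurable_funM.
  exact: measurable_powR.
apply: (measurableT_comp (measurable_powR _)).
exact: measurable_funB.
Qed.

(** The two endpoint powers have the explicit primitive [H] below, which has finite limits at 0 and
    1 because [a] and [b] are positive. *)
Let integral_pow_lt :
  (\int[mu]_(t in `]0%R, 1%R[) (t `^ (a - 1) + (1 - t) `^ (b - 1))%:E < +oo)%E.
Proof.
(* Starting at 1/3 ensures u n < 1 - u n. *)
pose u n : R := n.+3%:R^-1.
have u0 n : 0 < u n by rewrite invr_gt0.
have un : nonincreasing_seq u.
  by move=> n m nm; rewrite lef_pV2 ?posrE// ler_nat.
have u3 n : u n <= 3^-1 by rewrite lef_pV2 ?posrE// ler_nat.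
have cu : u n @[n --> \oo] --> (0 : R).
  have -> : u = [sequence harmonic (n + 2)%N]_n.
    by apply/funext => n; rewrite /= addn2.
  by rewrite (cvg_shiftn 2); exact: cvg_harmonic.
have cpow p : 0 < p -> u n `^ p @[n --> \oo] --> (0 : R).
  move=> p0; have [+ _] := cvg_at_rightP (fun z : R => z `^ p) 0 0.
  by apply => //; exact: powR_cvg0.
have cpowc (p z : R) : 0 < z -> {for z, continuous (fun y : R => y `^ p)}.
  move=> z0; apply/differentiable_continuous/derivable1_diffP.
  by have [] := is_derive1_powR p z0.
have cpow1 p : (1 - u n) `^ p @[n --> \oo] --> (1 : R).
  have c1 : 1 - u n @[n --> \oo] --> (1 : R).
    have c2 := cvgB (@cvg_cst _ (1 : R) _ \oo _) cu.
    by rewrite subr0 in c2; exact: c2.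
  have c3 : (1 - u n) `^ p @[n --> \oo] --> (1 : R) `^ p.
    exact: cvg_comp c1 (cpowc p 1 ltr01).
  by rewrite powR1 in c3; exact: c3.
pose H (t : R) : R := a^-1 * t `^ a - b^-1 * (1 - t) `^ b.
apply: (@le_lt_trans _ _
  (a^-1 * 1 - b^-1 * 0 - (a^-1 * 0 - b^-1 * 1))%:E); last exact: ltry.
rewrite le_eqVlt; apply/orP; left; apply/eqP.
apply: (@ge0_FTC_exhaustion R _ H _ u (fun n => 1 - u n)).
- by move=> n; have := u3 n; lra.
- exact: un.
- by move=> n m nm; rewrite lerD2l lerN2 un.
- apply/seteqP; split => [t [n _]|t]; rewrite /= !in_itv/=.
    by have := u0 n; lra.
  move=> /andP[t0 t1]; pose M := t^-1 + (1 - t)^-1.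
  have tV : 0 < t^-1 by rewrite invr_gt0.
  have tV' : 0 < (1 - t)^-1 by rewrite invr_gt0 subr_gt0.
  exists (Num.truncn M) => //=; rewrite in_itv/=.
  have Mn : M <= (Num.truncn M).+3%:R.
    by rewrite (le_trans (ltW (truncnS_gt _)))// ler_nat !ltnS ltnW.
  have h1 : u (Num.truncn M) <= t.
    by rewrite -[leRHS]invrK lef_pV2 ?posrE// (le_trans _ Mn)// lerDl ltW.
  have h2 : u (Num.truncn M) <= 1 - t.
    by rewrite -[leRHS]invrK lef_pV2 ?posrE// (le_trans _ Mn)// lerDr ltW.
  by rewrite h1/=; lra.
- by move=> t _; rewrite addr_ge0// powR_ge0.
- move=> t; rewrite /= in_itv/= => /andP[t0 t1].
  apply: cvgD; first exact: cpowc.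
  have t1' : 0 < 1 - t by rewrite subr_gt0.
  have cB : 1 - z @[z --> t] --> 1 - t.
    by apply: cvgB; [exact: cvg_cst|exact: cvg_id].
  exact: cvg_comp cB (cpowc (b - 1) (1 - t) t1').
- move=> t; rewrite /= in_itv/= => /andP[t0 t1].
  have dB : is_derive t 1 (fun z : R => 1 - z) (- 1).
    by rewrite -[- 1]sub0r; apply: is_deriveB.
  have t1' : 0 < 1 - t by rewrite subr_gt0.
  have D1 := is_deriveZ a^-1 (is_derive1_powR a t0).
  have D2 := is_deriveZ b^-1 (@is_derive1_comp _ (fun z => z `^ b)
    (fun z => 1 - z) _ _ _ (is_derive1_powR b t1') dB).
  have := is_deriveB D1 D2 => D; apply: (is_derive_eq D).
  by rewrite /GRing.scale/=; field; rewrite !gt_eqF.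
- apply: cvgB; apply: cvgM; try exact: cvg_cst.
    exact: cpow.
  exact: cpow1.
- apply: cvgB; apply: cvgM; try exact: cvg_cst.
    exact: cpow1.
  by under eq_fun do rewrite opprB addrC subrK; exact: cpow.
Qed.

(** Since [fine] sends +oo to 0, positivity requires finiteness as well as a positive lower bound,
    the latter taken on [1/4, 1/2]. *)
Lemma Beta_gt0 : 0 < Beta a b.
Proof.
rewrite /Beta /Rintegral fine_gt0//; apply/andP; split.
  pose k : R := 4 `^ (- `|a - 1|) * 4 `^ (- `|b - 1|).
  have sub : `[4^-1, 2^-1]%classic `<=` (`]0, 1[%classic : set R).
    by move=> t /=; rewrite !in_itv/=; lra.
  apply: (@lt_le_trans _ _ (\int[mu]_(t in `[4^-1%R, 2^-1%R]) k%:E)%E).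
    rewrite integral_cst//= lebesgue_measure_itv/= lte_fin ifT; last lra.
    by rewrite -EFinB -EFinM lte_fin mulr_gt0 ?mulr_gt0 ?powR_gt0//; lra.
  apply: (@le_trans _ _ (\int[mu]_(t in `[4^-1%R, 2^-1%R])
      (beta_integrand t)%:E)%E).
    apply: ge0_le_integral => //=.
    - by move=> t _; rewrite lee_fin mulr_ge0 ?powR_ge0.
    - exact: measurable_funS measurable_beta_integrand.
    - move=> t; rewrite in_itv/= => t01; rewrite lee_fin.
      have /andP[h1 _] : 4 `^ (- `|a - 1|) <= t `^ (a - 1) <= 4 `^ `|a - 1|.
        by apply: powR_bounds; lra.
      have /andP[h2 _] : 4 `^ (- `|b - 1|) <= (1 - t) `^ (b - 1) <= 4 `^ `|b - 1|.
        by apply: powR_bounds; lra.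
      by apply: ler_pM; rewrite ?powR_ge0.
  apply: ge0_subset_integral => //=.
  by move=> t _; rewrite lee_fin mulr_ge0 ?powR_ge0.
(* On each half of ]0, 1[ one factor of the integrand is bounded by [powR_bounds], and the other is
   one of the two endpoint powers. *)
pose K : R := 4 `^ `|a - 1| + 4 `^ `|b - 1|.
have K0 : 0 <= K by rewrite addr_ge0 ?powR_ge0.
have msum : measurable_fun (`]0, 1[ : set R)
    (fun t => t `^ (a - 1) + (1 - t) `^ (b - 1)).
  apply: measurable_funTS; apply: measurable_funD.
    exact: measurable_powR.
  apply: (measurableT_comp (measurable_powR _)).
  exact: measurable_funB.
apply: (@le_lt_trans _ _ (\int[mu]_(t in `]0%R, 1%R[)
    (K%:E * (t `^ (a - 1) + (1 - t) `^ (b - 1))%:E))%E).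
  apply: ge0_le_integral => //=.
  - by move=> t _; rewrite lee_fin mulr_ge0 ?powR_ge0.
  - by apply/measurable_EFinP; apply: measurable_funM => //; exact: msum.
  - move=> t; rewrite in_itv/= => t01; rewrite lee_fin.
    have p1 := powR_ge0 t (a - 1); have p2 := powR_ge0 (1 - t) (b - 1).
    have q1 := powR_ge0 4 `|a - 1|; have q2 := powR_ge0 4 `|b - 1|.
    rewrite /K; have [tl|tr] := leP t 2^-1.
      have /andP[_ h2] : 4 `^ (- `|b - 1|) <= (1 - t) `^ (b - 1) <= 4 `^ `|b - 1|.
        by apply: powR_bounds; lra.
      by nra.
    have /andP[_ h1] : 4 `^ (- `|a - 1|) <= t `^ (a - 1) <= 4 `^ `|a - 1|.
      by apply: powR_bounds; lra.
    by nra.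
rewrite ge0_integralZl_EFin//=.
- by rewrite lte_mul_pinfty.
- by move=> t _; rewrite lee_fin addr_ge0 ?powR_ge0.
- exact/measurable_EFinP.
Qed.

End BetaPositive.

(** * Integrating the series against the heat kernel *)

Section PolyaIntegral.
Variables (R : realType) (p : R).
Hypothesis p0 : 0 < p.
Notation mu := (@lebesgue_measure R).
Implicit Types m x : R.

(** A theta-type series, unrelated to the parameter (a - b) / 2 called [theta] in [polya_weight].
    The argument [x / 2] absorbs the factor 1/2 of the exponents. *)
Definition polya_theta x : R := limn (series (polya_term p (x / 2))).

Lemma polya_theta_ge0 x : 0 < x -> 0 <= polya_theta x.
Proof. by move=> x0; apply: polya_series_ge0 => //; exact: divr_gt0. Qed.

Lemma cvg_polya_theta x : 0 < x ->
  series (polya_term p (x / 2)) @ \oo --> polya_theta x.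
Proof. by move=> x0; apply: is_cvg_series_polya_term => //; exact: divr_gt0. Qed.

Lemma measurable_polya_theta : measurable_fun (`]0, +oo[ : set R) polya_theta.
Proof.
apply: (measurable_fun_cvg (h := fun n x => series (polya_term p (x / 2)) n)).
  move=> n; apply: measurable_sum => k.
  apply: measurable_funTS; apply: measurable_funM => //.
  apply: measurable_funM => //; apply: measurableT_comp => //.
  apply: measurableT_comp => //; apply: measurable_funM => //.
  exact: measurable_funM.
by move=> x; rewrite /= in_itv/= andbT; exact: cvg_polya_theta.
Qed.

Lemma measurable_heat_theta m :
  measurable_fun (`]0, +oo[ : set R) (fun x => (heat m x * polya_theta x)%:E).
Proof.
apply/measurable_EFinP; apply: measurable_funM; first exact: measurable_heat.
exact: measurable_polya_theta.
Qed.

Let c k : R := p / 2 + k%:R.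

Let c_gt0 k : 0 < c k.
Proof. by rewrite ltr_wpDr// divr_gt0. Qed.

(** The factor c_k of [polya_coef] cancels the 1/c_k from [integral_ig_fun], leaving a binomial term
    at exp (- m). *)
Let integral_coef_ig_fun m k : 0 < m ->
  (\int[mu]_(x in `]0%R, +oo[) (polya_coef p k * ig_fun m (c k) x)%:E =
   (expR (- (p / 2 * m)) * (negbinom p k * expR (- m) ^+ k))%:E)%E.
Proof.
move=> m0; under eq_integral do rewrite EFinM.
rewrite ge0_integralZl_EFin ?polya_coef_ge0//=; last 2 first.
- by move=> x _; rewrite lee_fin ig_fun_ge0.
- by apply/measurable_EFinP; exact: measurable_ig_fun.
rewrite integral_ig_fun// -EFinM; congr EFin.
rewrite -expRM_natl /polya_coef -/(c k).
have -> : expR (- (c k * m)) = expR (- (p / 2 * m)) * expR (k%:R * - m).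
  rewrite -expRD; congr expR; rewrite /c; ring.
by field; rewrite gt_eqF.
Qed.

Let F m k x := (polya_coef p k * ig_fun m (c k) x)%:E.

Let F0 m k x : (0 <= F m k x)%E.
Proof. by rewrite lee_fin mulr_ge0 ?polya_coef_ge0 ?ig_fun_ge0. Qed.

Let mF m k : measurable_fun (`]0, +oo[ : set R) (F m k).
Proof.
by apply/measurable_EFinP; apply: measurable_funM => //; exact: measurable_ig_fun.
Qed.

(** Without signs, the termwise integrals are those of the binomial series at exp (- m), which is
    below 1 exactly because m > 0; [negbinom_sum_le] bounds them. *)
Let integrable_dominant m : 0 < m ->
  mu.-integrable (`]0, +oo[ : set R) (fun x => \sum_(0 <= k <oo) F m k x)%E.
Proof.
move=> m0; apply/integrableP; split.
  by apply: ge0_emeasurable_sum => *; [exact: F0|exact: mF].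
under eq_integral do rewrite gee0_abs ?nneseries_ge0//.
rewrite integral_nneseries//; last by move=> n; exact: mF.
have em : 0 <= expR (- m) < 1.
  by rewrite expR_ge0 -expR0 ltr_expR oppr_lt0.
apply: (@le_lt_trans _ _
  (expR (- (p / 2 * m)) * (1 - expR (- m)) `^ (- p))%:E); last exact: ltry.
apply: lime_le.
  by apply: is_cvg_nneseries => k _ _; apply: integral_ge0 => x _; exact: F0.
apply: nearW => n; rewrite big_mkord.
under eq_bigr => k _ do rewrite integral_coef_ig_fun//.
rewrite sumEFin lee_fin -mulr_sumr ler_wpM2l ?expR_ge0//.
exact: negbinom_sum_le.
Qed.

Lemma integral_heat_theta_gt0 m : 0 < m ->
  (\int[mu]_(x in `]0%R, +oo[) (heat m x * polya_theta x)%:E =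
   (expR (- (p / 2 * m)) * (1 + expR (- m)) `^ (- p))%:E)%E.
Proof.
move=> m0.
pose f n x := (heat m x * series (polya_term p (x / 2)) n)%:E.
have fE n x : f n x = (\sum_(k < n) ((- 1) ^+ k)%:E * F m k x)%E.
  rewrite /f /series/= big_mkord mulr_sumr -sumEFin; apply: eq_bigr => k _.
  rewrite /F /ig_fun -EFinM /polya_term -/(c k); congr EFin.
  by rewrite mulrCA; congr (_ * _); rewrite mulrCA.
have intF k : mu.-integrable (`]0, +oo[ : set R) (F m k).
  apply/integrableP; split; first exact: mF.
  under eq_integral do rewrite gee0_abs//.
  by rewrite integral_coef_ig_fun// ltry.
have int_f n : (\int[mu]_(x in `]0%R, +oo[) f n x =
    (expR (- (p / 2 * m)) * negbinom_sum p n (- expR (- m)))%:E)%E.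
  under eq_integral do rewrite fE.
  rewrite integral_sum//; last by move=> k; exact: integrableZl.
  rewrite /negbinom_sum mulr_sumr -sumEFin; apply: eq_bigr => k _.
  rewrite integralZl// integral_coef_ig_fun// -EFinM; congr EFin.
  by rewrite [in RHS]exprNn mulrCA; congr (_ * _); rewrite mulrCA.
have [||||||_ _ cv] := @dominated_convergence _ _ _ mu (`]0, +oo[ : set R) _ f
  (fun x => (heat m x * polya_theta x)%:E) (fun x => \sum_(0 <= k <oo) F m k x)%E.
- by [].
- move=> n; rewrite (funext (fE n)).
  by apply: emeasurable_sum => k; apply: measurable_funeM; exact: mF.
- exact: measurable_heat_theta.
- apply: aeW => x; rewrite /= in_itv/= andbT => x0.
  apply: cvg_EFin; first exact: nearW.
  by apply: cvgM; [exact: cvg_cst|exact: cvg_polya_theta].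
- exact: integrable_dominant.
- apply: aeW => x n _; rewrite fE.
  apply: (@le_trans _ _ (\sum_(0 <= k < n) F m k x)%E); last first.
    by apply: nneseries_lim_ge => k _ _; exact: F0.
  rewrite big_mkord; apply: (le_trans (lee_abs_sum _ _ _)).
  apply: lee_sum => k _; rewrite abseM (gee0_abs (F0 _ _ _))/=.
  by rewrite normrX normrN1 expr1n mul1e.
apply: cvg_unique cv _ => //=.
under eq_fun do rewrite int_f.
apply: cvg_EFin; first exact: nearW.
apply: cvgM; first exact: cvg_cst.
apply: cvg_negbinom_sum => //.
by rewrite expR_ge0 -expR0 ltr_expR oppr_lt0.
Qed.

Lemma integral_heat0_theta :
  (\int[mu]_(x in `]0%R, +oo[) (heat 0 x * polya_theta x)%:E =
   (2 `^ (- p))%:E)%E.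
Proof.
pose f n x := (heat n.+1%:R^-1 x * polya_theta x)%:E.
have cV : n.+1%:R^-1 @[n --> \oo] --> (0 : R) by exact: cvg_harmonic.
have cv1 : (\int[mu]_(x in `]0%R, +oo[) f n x @[n --> \oo] --> (2 `^ (- p))%:E)%E.
  under eq_fun do rewrite integral_heat_theta_gt0 ?invr_gt0//.
  apply: cvg_EFin; first exact: nearW.
  have cV1 : 1 + expR (- n.+1%:R^-1) @[n --> \oo] --> (2 : R).
    have -> : 2 = 1 + expR (- 0) :> R by rewrite oppr0 expR0; ring.
    apply: cvgD; first exact: cvg_cst.
    by apply: continuous_cvg; [exact: continuous_expR|exact: cvgN].
  have cV2 : - (p / 2 * n.+1%:R^-1) @[n --> \oo] --> - (p / 2 * 0).
    by apply: cvgN; apply: cvgM => //; exact: cvg_cst.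
  have cpow : {for 2, continuous (fun z : R => z `^ (- p))}.
    apply/differentiable_continuous/derivable1_diffP.
    by have [] := is_derive1_powR (- p) (ltr0n R 2).
  have -> : 2 `^ (- p) = expR (- (p / 2 * 0)) * 2 `^ (- p).
    by rewrite mulr0 oppr0 expR0 mul1r.
  apply: cvgM; last exact: cvg_comp cV1 cpow.
  by apply: continuous_cvg => //; exact: continuous_expR.
have cv2 : (\int[mu]_(x in `]0%R, +oo[) f n x @[n --> \oo] -->
    \int[mu]_(x in `]0%R, +oo[) (heat 0 x * polya_theta x)%:E)%E.
  have -> : (\int[mu]_(x in `]0%R, +oo[) (heat 0 x * polya_theta x)%:E)%E =
      (\int[mu]_(x in `]0%R, +oo[) limn (f ^~ x))%E.
    apply: eq_integral => x; rewrite inE/= in_itv/= andbT => x0.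
    apply/esym/cvg_lim => //; apply: cvg_EFin; first exact: nearW.
    apply: cvgM; last exact: cvg_cst.
    rewrite /heat; apply: cvgM; first exact: cvg_cst.
    apply: continuous_cvg; first exact: continuous_expR.
    apply: cvgN; apply: cvgM; last exact: cvg_cst.
    by apply: cvgM.
  apply: cvg_monotone_convergence => //.
  - by move=> n; exact: measurable_heat_theta.
  - move=> n x; rewrite /= in_itv/= andbT => x0.
    by rewrite lee_fin mulr_ge0 ?heat_ge0 ?polya_theta_ge0.
  - move=> x; rewrite /= in_itv/= andbT => x0 n k nk.
    rewrite lee_fin ler_wpM2r ?polya_theta_ge0// /heat ler_wpM2l ?invr_ge0 ?sqrtr_ge0//.
    rewrite ler_expR lerN2 ler_wpM2r// ?invr_ge0 ?mulr_ge0 ?(ltW x0)//.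
    by rewrite lerXn2r ?nnegrE ?invr_ge0// lef_pV2 ?posrE// ler_nat.
exact: cvg_unique cv2 cv1.
Qed.

(** Both sides are even in [m], the right one being (2 cosh (m / 2))^(-p), so negative [m] reduces
    to positive [m]. *)
Lemma integral_heat_theta m :
  (\int[mu]_(x in `]0%R, +oo[) (heat m x * polya_theta x)%:E =
   (expR (- (p / 2 * m)) * (1 + expR (- m)) `^ (- p))%:E)%E.
Proof.
have heatN x : heat (- m) x = heat m x by rewrite /heat sqrrN.
have [mN|m0|->] := ltgtP m 0; last 2 first.
- exact: integral_heat_theta_gt0.
- rewrite integral_heat0_theta mulr0 oppr0 expR0 mul1r.
  by congr (_ `^ _)%:E; ring.
under eq_integral do rewrite -heatN.
have m0 : 0 < - m by rewrite oppr_gt0.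
rewrite (integral_heat_theta_gt0 m0); apply: (congr1 EFin).
have e1 : 0 < 1 + expR (- m) by rewrite ltr_wpDr ?expR_ge0.
have e2 : 0 < 1 + expR m by rewrite ltr_wpDr ?expR_ge0.
rewrite opprK /powR (gt_eqF e1) (gt_eqF e2) -!expRD; congr expR.
have -> : 1 + expR m = expR m * (1 + expR (- m)).
  by rewrite mulrDr mulr1 -expRD subrr expR0 addrC.
by rewrite lnM ?posrE ?expR_gt0// expRK; field.
Qed.

End PolyaIntegral.

(** * The Polya density in terms of the theta series, and the final identity *)

Lemma polya_densityE (R : realType) (a b x : R) : 0 < a -> 0 < b -> 0 < x ->
  polya_density a b x = (Beta a b)^-1 *
    (expR (((a - b) / 2) ^+ 2 * (x / 2)) * polya_theta (a + b) x).
Proof.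
move=> a0 b0 x0; rewrite /polya_density [RHS]mulrA.
set K := (Beta a b)^-1 * _; set u := fun k => _.
have -> : u = K *: polya_term (a + b) (x / 2).
  apply/funext => k.
  rewrite -[RHS]/(K * polya_term (a + b) (x / 2) k).
  rewrite /u /K /polya_weight /polya_term /polya_coef.
  have -> : (a + b) / 2 + (a - b) / 2 = a by field.
  have -> : (a + b) / 2 - (a - b) / 2 = b by field.
  have -> : 2 * ((a + b) / 2) = a + b by field.
  (* The rate (a + k) (b + k) equals ((a + b) / 2 + k)^2 - ((a - b) / 2)^2. *)
  have -> : expR (- (1 / 2) * polya_rate a b k * x) =
      expR (((a - b) / 2) ^+ 2 * (x / 2)) *
      expR (- (((a + b) / 2 + k%:R) ^+ 2 * (x / 2))).
    by rewrite -expRD; congr expR; rewrite /polya_rate; field.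
  by rewrite gbinomN; set s := (- 1) ^+ k; ring.
rewrite lim_seriesZ//; apply: is_cvg_series_polya_term.
  exact: addr_gt0.
exact: divr_gt0.
Qed.

Theorem mainTheorem2 (R : realType) (kappa a b mu : R)
    (kappa_gt0 : 0 < kappa) (a_gt0 : 0 < a) (b_gt0 : 0 < b)
    (abE : a + b = kappa) :
  (((1 + expR (- mu)) `^ (- kappa))%:E =
   (Beta a b * expR (a * mu))%:E *
   \int[lebesgue_measure]_(lambda in `]0%R, +oo[)
      (1 / Num.sqrt (2 * pi * lambda)
       * expR (- (1 / (2 * lambda))
               * (- mu - 1 / 2 * (a - b) * lambda) ^+ 2)
       * polya_density a b lambda)%:E)%E.
Proof.
have B0 := Beta_gt0 a_gt0 b_gt0.
pose K := (Beta a b)^-1 * expR (- ((a - b) / 2 * mu)).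
have K0 : 0 <= K by rewrite mulr_ge0 ?expR_ge0// invr_ge0 ltW.
rewrite (_ : integral _ _ _ =
    (\int[lebesgue_measure]_(x in `]0%R, +oo[)
      (K%:E * (heat mu x * polya_theta kappa x)%:E))%E); last first.
  apply: eq_integral => x; rewrite inE/= in_itv/= andbT => x0.
  rewrite polya_densityE// abE -EFinM; congr EFin.
  rewrite /heat /K div1r.
  (* Expanding the square, the term linear in x cancels the exponential factor of [polya_densityE],
     and the cross term is free of x and goes into [K]. *)
  have E : expR (- (1 / (2 * x)) * (- mu - 1 / 2 * (a - b) * x) ^+ 2) *
      expR (((a - b) / 2) ^+ 2 * (x / 2)) =
      expR (- ((a - b) / 2 * mu)) * expR (- (mu ^+ 2 / (2 * x))).
    by rewrite -!expRD; congr expR; field; rewrite gt_eqF.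
  transitivity ((Num.sqrt (2 * pi * x))^-1 * (Beta a b)^-1 *
    polya_theta kappa x *
    (expR (- (1 / (2 * x)) * (- mu - 1 / 2 * (a - b) * x) ^+ 2) *
      expR (((a - b) / 2) ^+ 2 * (x / 2)))); first by ring.
  by rewrite E; ring.
rewrite ge0_integralZl_EFin//=; last 2 first.
- move=> x; rewrite in_itv/= andbT => x0.
  by rewrite lee_fin mulr_ge0 ?heat_ge0 ?polya_theta_ge0.
- exact: measurable_heat_theta.
rewrite integral_heat_theta// -!EFinM; congr EFin.
rewrite /K mulrACA !mulrA divff ?mul1r ?gt_eqF// -!expRD.
(* The exponents a, -(a - b) / 2 and -(a + b) / 2 of exp mu add up to 0. *)
rewrite (_ : _ - _ = 0) ?expR0 ?mul1r//.
by rewrite -abE; field.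
Qed.
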